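(* Let $T\in(0,\infty)$, $p\in(1,\infty)$, $\beta\in(\frac1p,1]$, let $(\theta^N)_{N\in\mathbb N}\subseteq\mathcal P_T$ satisfy $\limsup_{N\to\infty}d_{\max}(\theta^N)=0$, let $(\Omega,\mathcal F,\mathbb P)$ be a probability space, let $(E,\|\cdot\|_E)$ be a Banach space, write $\mathcal L^p=\mathcal L^p(\mathbb P;\|\cdot\|_E)$, let $Y^N\colon[0,T]\times\Omega\to E$, $N\in\mathbb N_0$, be $(\mathcal F,\|\cdot\|_E)$-strongly measurable stochastic processes with continuous sample paths which satisfy $Y^0_0\in\mathcal L^p$ and $$|Y^0|_{\mathcal C^\beta([0,T],\|\cdot\|_{\mathcal L^p})}+\sup_{N\in\mathbb N}\Bigl[|d_{\max}(\theta^N)|^{-\beta}\sup_{t\in\theta^N}\|Y^0_t-Y^N_t\|_{\mathcal L^p}\Bigr]<\infty,$$ and assume that at least one of the following two conditions holds: (a) $\sup_{N\in\mathbb N}|Y^N|_{\mathcal C^\beta([0,T],\|\cdot\|_{\mathcal L^p})}<\infty$; (b) $\sup_{N\in\mathbb N}\frac{d_{\max}(\theta^N)}{d_{\min}(\theta^N)}<\infty$ and $\forall\,N\in\mathbb N\colon Y^N=[Y^N]_{\theta^N}$. Then for all $\alpha\in[0,\beta-\frac1p)$, $\varepsilon\in(0,\infty)$ it holds that $$\sup_{N\in\mathbb N}\Bigl[\mathbb E\bigl[\|Y^N\|^p_{\mathcal C^\alpha([0,T],\|\cdot\|_E)}\bigr]+|d_{\max}(\theta^N)|^{-(\beta-\alpha-\frac1p-\varepsilon)}\Bigl(\mathbb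 E\bigl[\|Y^0-Y^N\|^p_{\mathcal C^\alpha([0,T],\|\cdot\|_E)}\bigr]\Bigr)^{1/p}\Bigr]<\infty.$$
   Context: $\mathbb N=\{1,2,\dots\}$, $\mathbb N_0=\mathbb N\cup\{0\}$. $\mathcal P_T$ is the set of all finite sets $\theta\subseteq[0,T]$ with $\{0,T\}\subseteq\theta$. For $\theta=\{\theta_0<\theta_1<\dots<\theta_n\}\in\mathcal P_T$, $d_{\max}(\theta)=\max_{j\in\{1,\dots,n\}}|\theta_j-\theta_{j-1}|$ and $d_{\min}(\theta)=\min_{j\in\{1,\dots,n\}}|\theta_j-\theta_{j-1}|$. For $f\colon[0,T]\to E$, $[f]_\theta\colon[0,T]\to E$ is the piecewise affine linear interpolation: for $j\in\{1,\dots,n\}$, $s\in[\theta_{j-1},\theta_j]$, $[f]_\theta(s)=\frac{(\theta_j-s)f(\theta_{j-1})}{\theta_j-\theta_{j-1}}+\frac{(s-\theta_{j-1})f(\theta_j)}{\theta_j-\theta_{j-1}}$; for a process it is applied to each sample path. A stochastic process $X\colon[0,T]\times\Omega\to E$ is $(\mathcal F,\|\cdot\|_E)$-strongly measurable if each $X_t\colon\Omega\to E$ is strongly measurable. For a strongly measurable $Z\colon\Omega\to E$, $\|Z\|_{\mathcal L^p(\mathbb P;\|\cdot\|_E)}=(\mathbb E[\|Z\|_E^p])^{1/p}\in[0,\infty]$, and $Z\in\mathcal L^p(\mathbb P;\|\cdot\|_E)$ means that this is finite. For a vector space $V$ with a seminorm $\|\cdot\|$ which may take the value $\infty$, $r\in[0,1]$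 and $f\colon[0,T]\to V$: $|f|_{\mathcal C^r([0,T],\|\cdot\|)}=\sup_{s\neq t}\|f(t)-f(s)\|/|t-s|^r\in[0,\infty]$ and $\|f\|_{\mathcal C^r([0,T],\|\cdot\|)}=\sup_t\|f(t)\|+|f|_{\mathcal C^r([0,T],\|\cdot\|)}$. For $\|\cdot\|=\|\cdot\|_{\mathcal L^p}$ a process is regarded as the function $t\mapsto X_t$ with values in strongly measurable functions; for $\|\cdot\|=\|\cdot\|_E$ the norm is applied to each sample path. *)

(* Defs.v *)
From HB Require Import structures.
From mathcomp Require Import all_boot all_order all_algebra finmap.
From mathcomp Require Import all_classical all_reals all_analysis.

Set Implicit Arguments.
Unset Strict Implicit.
Unset Printing Implicit Defensive.

Import Order.TTheory GRing.Theory Num.Theory.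
Import numFieldNormedType.Exports.

Local Open Scope classical_set_scope.
Local Open Scope ring_scope.

(* Functions on [0, T] are represented by functions on R; every notion below
   only looks at their values on [0, T]. *)

Section time_grids.
Context {R : realType}.
Implicit Types (T : R) (theta : {fset R}).

Definition time_grid T : set {fset R} :=
  [set theta | [/\ {subset theta <= `[0, T]}, 0 \in theta & T \in theta]].

(* theta_0 < theta_1 < ... < theta_n, so that #|` theta| = n + 1 *)
Definition knots theta : seq R := sort <=%O (enum_fset theta).

Definition gap theta (j : nat) : R := `|(knots theta)`_j - (knots theta)`_j.-1|.

Definition dmax theta : R := \big[Num.max/0]_(1 <= j < #|` theta|) gap theta j.

(* The unit of the iterated minimum is the gap j = 1, one of the gaps as soon
   as theta has two points, hence neutral. *)
Definition dmin theta : R :=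
  \big[Num.min/gap theta 1]_(1 <= j < #|` theta|) gap theta j.

End time_grids.

Section interpolation.
Context {R : realType} {E : lmodType R}.

Definition affine_between (a b : R) (f : R -> E) (s : R) : E :=
  ((b - s) / (b - a)) *: f a + ((s - a) / (b - a)) *: f b.

(* j is the least index j >= 1 with s <= theta_j; see [interpE]. *)
Definition interp (theta : {fset R}) (f : R -> E) (s : R) : E :=
  let j := maxn 1 (find (fun x => s <= x) (knots theta)) in
  affine_between (knots theta)`_j.-1 (knots theta)`_j f s.

Lemma size_knots (theta : {fset R}) : size (knots theta) = #|` theta|.
Proof. by rewrite size_sort. Qed.

Lemma knots_lt (theta : {fset R}) (i j : nat) : (i < j < #|` theta|)%N ->
  (knots theta)`_i < (knots theta)`_j.
Proof.
move=> /andP[ij jn].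
have srt : sorted <%R (knots theta).
  by rewrite lt_sorted_uniq_le sort_uniq fset_uniq sort_le_sorted.
by apply: (sorted_ltn_nth lt_trans) => //;
  rewrite inE size_knots // (ltn_trans ij).
Qed.

Lemma interpE (theta : {fset R}) (f : R -> E) (j : nat) (s : R) :
  (0 < j < #|` theta|)%N ->
  (knots theta)`_j.-1 <= s <= (knots theta)`_j ->
  interp theta f s =
  affine_between (knots theta)`_j.-1 (knots theta)`_j f s.
Proof.
move=> /andP[j0 jn] /andP[s1 s2]; rewrite /interp.
set i := find _ _.
have ij : (i <= j)%N.
  rewrite leqNgt; apply/negP => /(before_find 0); by rewrite s2.
have isz : (i < size (knots theta))%N.
  by rewrite (leq_ltn_trans ij) ?size_knots.
have si : s <= (knots theta)`_i by apply: (nth_find 0); rewrite has_find.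
have [ji|] := leqP j (maxn 1 i).
  suff -> : maxn 1 i = j by [].
  by apply/eqP; rewrite eqn_leq ji andbT geq_max j0.
rewrite gtn_max => /andP[j1 ltij].
have ij1 : i = j.-1.
  apply/eqP; rewrite eqn_leq -ltnS prednK // ltij /= leqNgt; apply/negP => h.
  have : (knots theta)`_i < (knots theta)`_j.-1.
    by apply: knots_lt; rewrite h (leq_ltn_trans (leq_pred _)).
  by rewrite ltNge (le_trans s1).
have sE : s = (knots theta)`_j.-1 by apply/eqP; rewrite eq_le s1 -{1}ij1 si.
have i0 : (0 < i)%N by rewrite ij1 -ltnS prednK.
rewrite (maxn_idPr i0) ij1 /affine_between -sE.
have d1 : s - (knots theta)`_j.-2 != 0.
  rewrite gt_eqF // subr_gt0 {1}sE knots_lt //.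
  rewrite -ij1 prednK // leqnn /= -size_knots //.
have d2 : (knots theta)`_j - s != 0.
  by rewrite gt_eqF // subr_gt0 {1}sE knots_lt // prednK // leqnn.
by rewrite !subrr !mul0r !divff // !scale0r scale1r add0r addr0.
Qed.

End interpolation.

Section holder.
Context {R : realType} {V : zmodType}.
Local Open Scope ereal_scope.

(* nrm is a seminorm on V with values in [0, +oo] *)
Definition holder_seminorm (nrm : V -> \bar R) (T r : R) (f : R -> V) :=
  ereal_sup [set nrm (f u.1 - f u.2)%R / ((`|u.1 - u.2| `^ r)%R)%:E |
    u in [set u : R * R | [/\ u.1 \in `[0%R, T], u.2 \in `[0%R, T]
                            & u.1 != u.2]]].

Definition holder_norm (nrm : V -> \bar R) (T r : R) (f : R -> V) :=
  ereal_sup [set nrm (f t) | t in `[0%R, T]] + holder_seminorm nrm T r f.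

End holder.

Section random_variables.
Context {d : measure_display} {Omega : measurableType d} {R : realType}
  {E : normedModType R}.

Definition simple_fun (S : Omega -> E) : Prop :=
  finite_set (range S) /\ forall x : E, measurable (S @^-1` [set x]).

(* pointwise limit of simple functions *)
Definition strongly_measurable (Z : Omega -> E) : Prop :=
  exists S : nat -> Omega -> E,
    (forall n, simple_fun (S n)) /\
    forall w, S n w @[n --> \oo] --> Z w.

Definition norme (x : E) : \bar R := `|x|%:E.

Definition Lpnorm (P : probability Omega R) (p : R) (Z : Omega -> E) : \bar R :=
  Lnorm P p%:E (norme \o Z).

Definition in_Lp (P : probability Omega R) (p : R) (Z : Omega -> E) : Prop :=
  strongly_measurable Z /\ (Lpnorm P p Z < +oo)%E.

End random_variables.

(* Main.v *)
Require Import Defs.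
From HB Require Import structures.
From mathcomp Require Import all_boot all_order all_algebra finmap.
From mathcomp Require Import all_classical all_reals all_analysis.
From mathcomp Require Import measurable_realfun lra.
Set Implicit Arguments.
Unset Strict Implicit.
Unset Printing Implicit Defensive.
Import Order.TTheory GRing.Theory Num.Theory.
Import numFieldNormedType.Exports.
Local Open Scope classical_set_scope.
Local Open Scope ring_scope.

(* The L^p bounds on increments are turned into pathwise Hoelder bounds by
   dyadic chaining: if A bounds the p-th power sum over all dyadic levels m of
   2^(a p m) |f(T(k+1)/2^m) - f(T k/2^m)|^p, then |f|_{C^a} is at most a
   constant times A^(1/p), and the expectation of that sum is a geometric series
   as soon as E|X_t - X_s|^p <= M |t - s|^(gamma p) with gamma > a + 1/p.
   Applied with gamma = beta to Y^N, this bounds the first summand; under (b)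
   the increments of Y^N are first controlled at the grid points, where Y^N is
   close to Y^0 and d_max is comparable with the distance, and then by
   linearity in between.  For D = Y^0 - Y^N one has both
   E|D_t - D_s|^p <= C |t - s|^(beta p) and E|D_t|^p <= C d_max^(beta p), hence
   E|D_t - D_s|^p <= C d_max^((beta - gamma) p) |t - s|^(gamma p) for any
   gamma <= beta, and gamma slightly above alpha + 1/p gives the rate.
   Constants are irrelevant, so |a + b|^p <= 2^p (|a|^p + |b|^p) replaces
   Minkowski's inequality throughout. *)

(** * Moments of strongly measurable maps *)

Section strongly_measurable.
Context {d : measure_display} {Omega : measurableType d} {R : realType}.

Lemma simple_fun_preimage (E : normedModType R) (S : Omega -> E) (B : set E) :
  simple_fun S -> measurable (S @^-1` B).
Proof.
move=> [fS mS].
have -> : S @^-1` B = \bigcup_(x in range S `&` B) S @^-1` [set x].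
  apply/seteqP; split => [w Bw|w [x [_ Bx] /= ->]] //=.
  by exists (S w) => //; split => //; exists w.
apply: fin_bigcup_measurable => //; exact: finite_setIl.
Qed.

(** Over the finitely many values [a] of [S], a level set of the combined map splits into preimages
    under [S] and under [S'] separately. *)
Lemma simple_fun_comp2 (E F G : normedModType R) (h : E -> F -> G)
    (S : Omega -> E) (S' : Omega -> F) :
  simple_fun S -> simple_fun S' -> simple_fun (fun w => h (S w) (S' w)).
Proof.
move=> hS hS'; have [fS _] := hS; have [fS' _] := hS'; split.
  apply: (sub_finite_set _ (finite_image2 h fS fS')).
  by move=> _ [w _ <-]; exists (S w); [exists w|exists (S' w) => //; exists w].
move=> x; have -> : (fun w => h (S w) (S' w)) @^-1` [set x] =
    \bigcup_(a in range S) (S @^-1` [set a] `&` S' @^-1` [set b | h a b = x]).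
  apply/seteqP; split => [w /= hx|w [a _ [/= -> //]]].
  by exists (S w) => //; exists w.
apply: fin_bigcup_measurable => // a _.
by apply: measurableI; apply: simple_fun_preimage.
Qed.

(** [E] carries no sigma-algebra here; measurability enters through the real functions [|S n|],
    which converge pointwise to [|Z|]. *)
Lemma measurable_norm_strong (E : normedModType R) (Z : Omega -> E) :
  strongly_measurable Z -> measurable_fun setT (fun w => `|Z w|).
Proof.
move=> [S [simS cvS]].
apply: (@measurable_fun_cvg _ _ _ _ (fun n w => `|S n w|)) => [n _ B mB|w _].
  by rewrite setTI; exact: (simple_fun_preimage (fun x => B `|x|) (simS n)).
exact: cvg_norm.
Qed.

Context {E : normedModType R}.

Lemma strongly_measurableD (Z1 Z2 : Omega -> E) :
  strongly_measurable Z1 -> strongly_measurable Z2 ->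
  strongly_measurable (Z1 + Z2).
Proof.
move=> [S1 [sS1 cS1]] [S2 [sS2 cS2]].
exists (fun n w => S1 n w + S2 n w); split => [n|w]; last exact: cvgD.
exact: (simple_fun_comp2 +%R).
Qed.

Lemma strongly_measurableB (Z1 Z2 : Omega -> E) :
  strongly_measurable Z1 -> strongly_measurable Z2 ->
  strongly_measurable (Z1 - Z2).
Proof.
move=> [S1 [sS1 cS1]] [S2 [sS2 cS2]].
exists (fun n w => S1 n w - S2 n w); split => [n|w]; last exact: cvgB.
exact: (simple_fun_comp2 (fun x y => x - y)).
Qed.

End strongly_measurable.

(* Unlike [ge0_le_integral], no measurability is required: the integral of a
   nonnegative function is a supremum over the simple functions below it. *)
Lemma le_integral_nonneg {d : measure_display} {Omega : measurableType d}
    {R : realType} (mu : {measure set Omega -> \bar R}) (f g : Omega -> \bar R) :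
  (forall w, 0 <= f w)%E -> (forall w, f w <= g w)%E ->
  (\int[mu]_w f w <= \int[mu]_w g w)%E.
Proof.
move=> f0 fg; have g0 w : (0 <= g w)%E by apply: le_trans (f0 w) (fg w).
rewrite !ge0_integralTE//; apply: le_ereal_sup => _ [h hf <-].
by exists h => // w; exact: le_trans (hf w) (fg w).
Qed.

Section moment.
Context {d : measure_display} {Omega : measurableType d} {R : realType}.
Context {E : normedModType R} (P : probability Omega R) (p : R).
Hypothesis p_gt0 : 0 < p.
Implicit Types Z : Omega -> E.

(** The $p$-th power of [Lpnorm]; without the root, bounds on single increments can be summed under
    the integral. *)
Definition moment Z : \bar R := (\int[P]_w (`|Z w| `^ p)%:E)%E.

Lemma measurable_moment Z : strongly_measurable Z ->
  measurable_fun setT (fun w => (`|Z w| `^ p)%:E).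
Proof.
move=> mZ; apply/measurable_EFinP.
by apply: (measurableT_comp (measurable_powR p)); exact: measurable_norm_strong.
Qed.

Lemma moment_ge0 Z : (0 <= moment Z)%E.
Proof. by apply: integral_ge0 => w _; rewrite lee_fin powR_ge0. Qed.

Lemma moment_Lpnorm Z (M : R) : 0 <= M -> (Lpnorm P p Z <= M%:E)%E ->
  (moment Z <= (M `^ p)%:E)%E.
Proof.
move=> M0 le_M; have -> : moment Z = (Lpnorm P p Z `^ p)%E.
  rewrite /Lpnorm poweR_Lnorm ?gt_eqF//; apply: eq_integral => w _ /=.
  by rewrite normr_id.
by rewrite -poweR_EFin gt0_ler_poweR ?(ltW p_gt0)// in_itv /= leey ?Lnorm_ge0 ?lee_fin ?M0.
Qed.

Lemma momentN Z : moment (- Z) = moment Z.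
Proof. by apply: eq_integral => w _; rewrite fctE normrN. Qed.

Lemma momentBC Z1 Z2 : moment (Z1 - Z2) = moment (Z2 - Z1).
Proof. by rewrite -momentN opprB. Qed.

(** If [b] is the larger of the two, then [a + b] is at most [2 * b]. *)
Lemma powRD_le (a b : R) : 0 <= a -> 0 <= b ->
  (a + b) `^ p <= 2 `^ p * (a `^ p + b `^ p).
Proof.
move=> a0 b0.
wlog ab : a b a0 b0 / a <= b.
  move=> H; have [/H|/ltW/H] := leP a b; first exact.
  by rewrite addrC (addrC (b `^ p)); exact.
apply: (@le_trans _ _ ((2 * b) `^ p)).
  by apply: ge0_ler_powR; rewrite ?nnegrE ?(ltW p_gt0) //; lra.
by rewrite powRM// ler_wpM2l ?powR_ge0// lerDr powR_ge0.
Qed.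

Lemma momentD Z1 Z2 (a b : R) :
  strongly_measurable Z1 -> strongly_measurable Z2 ->
  (moment Z1 <= a%:E)%E -> (moment Z2 <= b%:E)%E ->
  (moment (Z1 + Z2)%R <= (2 `^ p * (a + b))%:E)%E.
Proof.
move=> m1 m2 le1 le2.
apply: (@le_trans _ _ (\int[P]_w ((2 `^ p)%:E *
    ((`|Z1 w| `^ p)%:E + (`|Z2 w| `^ p)%:E)))%E).
  apply: le_integral_nonneg => w; rewrite ?lee_fin ?powR_ge0//.
  apply: le_trans (powRD_le _ _) => //; apply: ge0_ler_powR.
  - exact: ltW.
  - by rewrite nnegrE.
  - by rewrite nnegrE addr_ge0.
  - exact: ler_normD.
rewrite ge0_integralZl_EFin ?powR_ge0//.
- rewrite EFinM lee_wpmul2l ?lee_fin ?powR_ge0//.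
  rewrite ge0_integralD//; first by rewrite EFinD leeD.
  + exact: measurable_moment.
  + exact: measurable_moment.
- by move=> w _; rewrite adde_ge0 ?lee_fin ?powR_ge0.
- by apply: emeasurable_funD; exact: measurable_moment.
Qed.

End moment.

(** The supremum of an empty set would be [-oo]; [0 < T] supplies the admissible pair [(T, 0)]. *)
Lemma holder_seminorm_ge0 {R : realType} {V : zmodType} (nrm : V -> \bar R)
    (T r : R) (f : R -> V) : 0 < T -> (forall v, 0 <= nrm v)%E ->
  (0 <= holder_seminorm nrm T r f)%E.
Proof.
move=> T0 nrm0; apply: le_trans (ereal_sup_ubound _); last first.
  by exists (T, 0) => //=; rewrite !in_itv /= !lexx !ltW//; split => //; rewrite gt_eqF.
by rewrite mule_ge0// inver gt_eqF ?lee_fin ?invr_ge0 ?powR_ge0 ?powR_gt0// normr_gt0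
  subr_eq0 gt_eqF.
Qed.

Lemma holder_norm_ge0 {R : realType} {V : zmodType} (nrm : V -> \bar R)
    (T r : R) (f : R -> V) : 0 < T -> (forall v, 0 <= nrm v)%E ->
  (0 <= holder_norm nrm T r f)%E.
Proof.
move=> T0 nrm0; rewrite adde_ge0 ?holder_seminorm_ge0//.
apply: le_trans (ereal_sup_ubound _); last first.
  by exists 0 => //=; rewrite in_itv /= lexx ltW.
exact: nrm0.
Qed.

(** * Dyadic chaining *)

Lemma powR2_gt1 {R : realType} (a : R) : 0 < a -> 1 < 2 `^ a.
Proof.
move=> a0; have := @gt0_ltr_powR R a a0 1 2; rewrite powR1 !nnegrE => -> //.
by rewrite ltr1n.
Qed.

Lemma powR2N_lt1 {R : realType} (a : R) : 0 < a -> 2 `^ (- a) < 1.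
Proof. by move=> a0; rewrite powRN invf_lt1 ?powR_gt0// powR2_gt1. Qed.

Section dyadic_chaining.
Context {R : realType} {E : normedModType R}.
Variables (T q A : R) (f : R -> E).

Definition dyadic (m k : nat) : R := T * (k%:R / 2 ^+ m).

Definition dyadic_floor (m : nat) (t : R) : R :=
  dyadic m (Num.truncn (2 ^+ m * (t / T))).

Hypothesis T_gt0 : 0 < T.
Hypothesis q_itv : 0 < q < 1.
Hypothesis A_ge0 : 0 <= A.
Hypothesis f_inc : forall m k, (k < 2 ^ m)%N ->
  `|f (dyadic m k.+1) - f (dyadic m k)| <= A * q ^+ m.
Hypothesis f_cont : {within `[0, T], continuous f}.

Lemma dyadic_double m k : dyadic m.+1 k.*2 = dyadic m k.
Proof.
rewrite /dyadic -mul2n natrM exprS invfM mulrACA divff ?mul1r//.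
Qed.

Let trunc_le m t : 0 <= t <= T ->
  (Num.truncn (2 ^+ m * (t / T)))%:R <= 2 ^+ m * (t / T) <
  (Num.truncn (2 ^+ m * (t / T))).+1%:R.
Proof.
move=> /andP[t0 tT]; apply: truncn_itv.
by rewrite mulr_ge0 ?exprn_ge0 ?divr_ge0// ltW.
Qed.

Lemma dyadic_floor_itv m t : 0 <= t <= T ->
  dyadic_floor m t <= t < dyadic_floor m t + T / 2 ^+ m.
Proof.
move=> t0T; have /andP[h1 h2] := trunc_le m t0T.
have e0 : 0 < 2 ^+ m :> R by rewrite exprn_gt0.
move: h1 h2; rewrite /dyadic_floor /dyadic; set k := Num.truncn _ => h1 h2.
rewrite mulrA ler_pdivlMr// in h1; rewrite mulrA ltr_pdivrMr// in h2.
rewrite mulrA -mulrDl ler_pdivrMr// ltr_pdivlMr//.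
rewrite (mulrC t) (mulrC T) h1/=.
by rewrite -[k.+1%:R]natr1 mulrDl mul1r in h2.
Qed.

Lemma dyadic_floor_ge0 m t : 0 <= dyadic_floor m t.
Proof. by rewrite mulr_ge0 ?divr_ge0 ?exprn_ge0// ltW. Qed.

Lemma dyadic_floor_le m t : 0 <= t <= T -> 0 <= dyadic_floor m t <= T.
Proof.
move=> t0T; rewrite dyadic_floor_ge0/=.
have /andP[h _] := dyadic_floor_itv m t0T.
by case/andP: t0T => _; exact: le_trans.
Qed.

Let trunc_bound m t : 0 <= t <= T ->
  (Num.truncn (2 ^+ m * (t / T)) <= 2 ^ m)%N.
Proof.
move=> t0T; have /andP[h1 _] := trunc_le m t0T.
rewrite -(ler_nat R) natrX (le_trans h1)// ler_piMr ?exprn_ge0//.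
by rewrite ler_pdivrMr ?mul1r//; case/andP: t0T.
Qed.

(** The integer part of $2x$ is $2\lfloor x\rfloor$ or $2\lfloor x\rfloor+1$, so the two floors
    coincide or are neighbours at level [m.+1]. *)
Lemma dyadic_floorS m t : 0 <= t <= T ->
  `|f (dyadic_floor m.+1 t) - f (dyadic_floor m t)| <= A * q ^+ m.+1.
Proof.
move=> t0T; have /andP[h1 h2] := trunc_le m t0T.
have /andP[k1 k2] := trunc_le m.+1 t0T; have := trunc_bound m.+1 t0T.
rewrite /dyadic_floor; move: k1 k2 h1 h2; rewrite exprS -mulrA.
set x := 2 ^+ m * _; set k := Num.truncn (2 * x); set j := Num.truncn x.
move=> k1 k2 h1 h2 kle.
have jk : (j.*2 <= k)%N.
  rewrite -ltnS -(ltr_nat R) (le_lt_trans _ k2)// -mul2n natrM.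
  by rewrite ler_wpM2l.
have kj : (k < j.*2.+2)%N.
  rewrite -doubleS -(ltr_nat R) (le_lt_trans k1)// -mul2n natrM.
  by rewrite ltr_pM2l.
rewrite -(dyadic_double m j).
move: kj; rewrite ltnS leq_eqVlt => /orP[/eqP kE|kj].
  by rewrite kE; apply: f_inc; rewrite -kE.
have -> : k = j.*2 by apply/eqP; rewrite eqn_leq jk -ltnS kj.
by rewrite subrr normr0 mulr_ge0// exprn_ge0//; case/andP: q_itv => /ltW.
Qed.

Lemma dyadic_floorD n j t : 0 <= t <= T ->
  `|f (dyadic_floor (n + j) t) - f (dyadic_floor n t)| <=
  A / (1 - q) * q ^+ n * (1 - q ^+ j).
Proof.
move=> t0T; have /andP[q0 q1] := q_itv.
have q1' : 0 < 1 - q by rewrite subr_gt0.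
elim: j => [|j ih]; first by rewrite addn0 !subrr normr0 mulr0.
rewrite addnS -[X in X - _](subrK (f (dyadic_floor (n + j) t))) -addrA.
apply: le_trans (ler_normD _ _) _.
apply: le_trans (lerD (dyadic_floorS _ t0T) ih) _.
have AE : A = A / (1 - q) * (1 - q) by rewrite divfK// gt_eqF.
have B0 : 0 <= A / (1 - q) by rewrite divr_ge0// ltW.
rewrite {1}AE exprS exprS exprD; move: (A / (1 - q)) B0 => B B0.
have u0 : 0 <= q ^+ n by rewrite exprn_ge0// ltW.
have v0 : 0 <= q ^+ j by rewrite exprn_ge0// ltW.
(* This product is the slack of the induction step: the bound grows by $Aq^{n+j}$, while the new
   increment costs only $Aq^{n+j+1}$. *)
have : 0 <= B * q ^+ n * q ^+ j * (1 - q) ^+ 2 by rewrite mulr_ge0 ?sqr_ge0// !mulr_ge0.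
move: (q ^+ n) (q ^+ j) => u v; rewrite expr2; lra.
Qed.

(** The floors of [t] converge to [t], and all their images from level [n] on lie in one closed
    ball, which therefore contains [f t]. *)
Lemma dyadic_floor_dist n t : 0 <= t <= T ->
  `|f t - f (dyadic_floor n t)| <= A / (1 - q) * q ^+ n.
Proof.
move=> t0T; have /andP[q0 q1] := q_itv.
have q1' : 0 < 1 - q by rewrite subr_gt0.
(* Continuity of [f] is relative to [[0, T]], so the convergence has to hold in the relative
   neighbourhood filter; the floors do stay in [[0, T]]. *)
have cvt : dyadic_floor (n + j) t @[j --> \oo] --> within `[0, T] (nbhs t).
  move=> B /= [e e0 Be].
  have : T * (2^-1 ^+ j) @[j --> \oo] --> (T * 0 : R).
    apply: cvgM; first exact: cvg_cst.
    by apply: cvg_expr; rewrite gtr0_norm// invf_lt1// ltr1n.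
  rewrite mulr0 => /cvgr0Pnorm_lt /(_ _ e0) [N _ hN].
  exists N => //= j /= Nj; apply: Be => /=; last first.
    by rewrite in_itv /=; exact: dyadic_floor_le.
  have /andP[h1 h2] := dyadic_floor_itv (n + j) t0T.
  rewrite ger0_norm ?subr_ge0// ltrBlDl (lt_le_trans h2)// lerD2l.
  apply: le_trans (ltW (hN j Nj)).
  rewrite ger0_norm ?mulr_ge0 ?exprn_ge0 ?(ltW T_gt0)//.
  rewrite ler_wpM2l ?(ltW T_gt0)// -exprVn ler_wiXn2l ?leq_addl//.
  by rewrite invf_le1// ler1n.
have cvf : f (dyadic_floor (n + j) t) @[j --> \oo] --> f t.
  move/subspace_continuousP : f_cont => /(_ t); rewrite /= in_itv /= => /(_ t0T).
  exact: cvg_comp.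
pose B := closed_ball_ Num.norm (f (dyadic_floor n t)) (A / (1 - q) * q ^+ n).
rewrite distrC; suff: B (f t) by [].
have cB : closed B by exact: closed_closed_ball_.
apply: (closed_cvg B cB _ _ cvf).
rewrite /B /closed_ball_ /=; apply: nearW => j; rewrite distrC.
apply: le_trans (dyadic_floorD n j t0T) _.
rewrite ler_piMr ?mulr_ge0 ?invr_ge0 ?exprn_ge0 ?(ltW q0) ?(ltW q1')//.
by rewrite gerBl exprn_ge0 ?ltW.
Qed.

(** Points at distance at most [T / 2 ^+ n] have equal or adjacent floors at level [n]. The two
    chains from the points to their floors give [2 / (1 - q)], the step between the floors gives
    [1]. *)
Lemma dyadic_chaining n s t : 0 <= s -> s <= t -> t <= T ->
  t - s <= T / 2 ^+ n ->
  `|f t - f s| <= A * (2 / (1 - q) + 1) * q ^+ n.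
Proof.
move=> s0 st tT tsn; have /andP[q0 q1] := q_itv.
have s0T : 0 <= s <= T by rewrite s0 (le_trans st).
have t0T : 0 <= t <= T by rewrite (le_trans s0 st).
have hstep : `|f (dyadic_floor n t) - f (dyadic_floor n s)| <= A * q ^+ n.
  have /andP[h1 h2] := trunc_le n t0T.
  have /andP[k1 k2] := trunc_le n s0T.
  have := trunc_bound n t0T; rewrite /dyadic_floor.
  move: h1 h2 k1 k2; set k := Num.truncn _; set j := Num.truncn (_ * (s / T)).
  move=> h1 h2 k1 k2 kle.
  have e0 : 0 < 2 ^+ n :> R by rewrite exprn_gt0.
  have ts1 : 2 ^+ n * (t / T) <= 2 ^+ n * (s / T) + 1.
    rewrite -lerBlDl -mulrBr -mulrBl mulrC -ler_pdivlMr// mul1r.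
    by rewrite ler_pdivrMr// mulrC.
  have ts0 : 2 ^+ n * (s / T) <= 2 ^+ n * (t / T).
    by rewrite ler_pM2l// ler_pM2r// invr_gt0.
  have jk : (j <= k)%N by rewrite -ltnS -(ltr_nat R) (le_lt_trans _ h2)// (le_trans k1).
  have kj : (k < j.+2)%N.
    rewrite -(ltr_nat R) (le_lt_trans h1)// (le_lt_trans ts1)//.
    by rewrite -[j.+2%:R]natr1 ltrD2r.
  move: kj; rewrite ltnS leq_eqVlt => /orP[/eqP kE|kj].
    by rewrite kE; apply: f_inc; rewrite -kE.
  have -> : k = j by apply/eqP; rewrite eqn_leq jk -ltnS kj.
  by rewrite subrr normr0 mulr_ge0// exprn_ge0// ltW.
have ht := dyadic_floor_dist n t0T.
have := dyadic_floor_dist n s0T; rewrite distrC => hs.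
rewrite mulrDr mulr1 mulrDl mulrCA -[X in _ <= X + _]mulrA.
have -> : f t - f s = (f t - f (dyadic_floor n t)) +
    (f (dyadic_floor n t) - f (dyadic_floor n s)) + (f (dyadic_floor n s) - f s).
  by rewrite !addrA !subrK.
apply: le_trans (ler_normD _ _) _.
have := ler_normD (f t - f (dyadic_floor n t)) (f (dyadic_floor n t) - f (dyadic_floor n s)).
set X := A / (1 - q) * q ^+ n in ht hs *.
lra.
Qed.

End dyadic_chaining.

Lemma dyadic_bracket {R : realType} (x : R) : 0 < x <= 1 ->
  exists n : nat, 2 ^- n.+1 < x <= 2 ^- n.
Proof.
move=> /andP[x0 x1].
have ex : exists n, (2 : R) ^- n < x.
  have : (2^-1 : R) ^+ j @[j --> \oo] --> (0 : R).
    by apply: cvg_expr; rewrite gtr0_norm// invf_lt1// ltr1n.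
  move=> /cvgr0Pnorm_lt /(_ _ x0) [N _ /(_ N (leqnn _))].
  by rewrite ger0_norm ?exprn_ge0// exprVn => ?; exists N.
(* The least exponent with $2^{-n}<x$ is not $0$ because $x\le 1$; its predecessor is the
   witness. *)
case: (ex_minnP ex) => -[|n] hn hmin; first by rewrite expr0 invr1 ltNge x1 in hn.
exists n; rewrite hn /= leNgt; apply/negP => /hmin.
by rewrite ltnn.
Qed.

Lemma dyadic_holder {R : realType} {E : normedModType R} (T a A : R) (f : R -> E) :
  0 < T -> 0 < a -> 0 <= A ->
  (forall m k, (k < 2 ^ m)%N ->
    `|f (dyadic T m k.+1) - f (dyadic T m k)| <= A * (2 `^ (- a)) ^+ m) ->
  {within `[0, T], continuous f} ->
  forall s t, 0 <= s <= T -> 0 <= t <= T ->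
  `|f t - f s| <= A * ((2 / (1 - 2 `^ (- a)) + 1) * 2 `^ a) * (`|t - s| / T) `^ a.
Proof.
move=> T0 a0 A0 f_inc f_cont.
have q01 : 0 < (2 : R) `^ (- a) < 1.
  by rewrite powR_gt0//= powR2N_lt1.
suff H s t : 0 <= s -> s < t -> t <= T ->
    `|f t - f s| <= A * ((2 / (1 - 2 `^ (- a)) + 1) * 2 `^ a) * ((t - s) / T) `^ a.
  move=> s t /andP[s0 sT] /andP[t0 tT].
  have [st|ts|->] := ltgtP s t.
  - by rewrite gtr0_norm ?subr_gt0//; exact: H.
  - by rewrite distrC ltr0_norm ?subr_lt0// opprB; exact: H.
  - rewrite subrr normr0 !mulr_ge0 ?powR_ge0// addr_ge0// divr_ge0//.
    by rewrite subr_ge0 ltW//; case/andP: q01.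
move=> s0 st tT.
have x01 : 0 < (t - s) / T <= 1.
  rewrite divr_gt0 ?subr_gt0//= ler_pdivrMr// mul1r; lra.
have [n /andP[n1 n2]] := dyadic_bracket x01.
have tsn : t - s <= T / 2 ^+ n by rewrite mulrC -ler_pdivrMr.
apply: le_trans (dyadic_chaining T0 q01 A0 f_inc f_cont s0 (ltW st) tT tsn) _.
rewrite -[leRHS]mulrA -mulrA ler_wpM2l//.
rewrite -[leRHS]mulrA ler_wpM2l//.
  by rewrite addr_ge0// divr_ge0// subr_ge0 ltW//; case/andP: q01.
apply: (@le_trans _ _ (2 `^ a * (2 ^- n.+1) `^ a)); last first.
  rewrite ler_wpM2l ?powR_ge0// ge0_ler_powR ?nnegrE ?(ltW a0)//.
  - by case/andP: x01 => /ltW.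
  - exact: ltW.
rewrite -powRM// ?invr_ge0 ?exprn_ge0//.
rewrite exprS invfM mulrA divff// mul1r -powR_mulrn ?powR_ge0//.
by rewrite -powR_mulrn// -powRN -!powRrM !mulNr mulrC.
Qed.

(** * Dyadic energies and pathwise Hölder norms *)

Section dyadic_energy.
Context {R : realType} {E : normedModType R}.
Variables (T p a : R).
Local Open Scope ereal_scope.

Definition level_energy (f : R -> E) (m : nat) : \bar R :=
  (((2 `^ (a * p)) ^+ m)%R)%:E *
  \sum_(k < 2 ^ m) ((`|f (dyadic T m k.+1) - f (dyadic T m k)| `^ p)%R)%:E.

(** The $p$-th power of a dyadic Besov-type seminorm of smoothness $a+1/p$. As a countable sum of
    nonnegative terms it can be integrated term by term, unlike the supremum in the Hölder norm. *)
Definition dyadic_energy (f : R -> E) : \bar R :=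
  \sum_(m <oo) level_energy f m.

Lemma level_energy_ge0 f m : 0 <= level_energy f m.
Proof.
rewrite mule_ge0 ?lee_fin ?exprn_ge0 ?powR_ge0//.
by apply: sume_ge0 => k _; rewrite lee_fin powR_ge0.
Qed.

Lemma dyadic_energy_ge0 f : 0 <= dyadic_energy f.
Proof. by apply: nneseries_ge0 => m _ _; exact: level_energy_ge0. Qed.

Lemma dyadic_energy_inc f (g : R) (m k : nat) : (0 < p)%R -> (k < 2 ^ m)%N ->
  dyadic_energy f <= g%:E ->
  (`|f (dyadic T m k.+1) - f (dyadic T m k)| <= g `^ p^-1 * (2 `^ (- a)) ^+ m)%R.
Proof.
move=> p0 km le_g; set x := (`| _ |)%R.
have g0 : (0 <= g)%R by rewrite -lee_fin (le_trans (dyadic_energy_ge0 f)).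
have : (((2 `^ (a * p)) ^+ m)%R)%:E * (x `^ p)%:E <= g%:E.
  apply: le_trans le_g; apply: le_trans (_ : level_energy f m <= _); last first.
    rewrite /dyadic_energy (@nneseriesD1 _ _ m)//=; last first.
      by move=> i _; exact: level_energy_ge0.
    rewrite leeDl//; apply: nneseries_ge0 => i _ _; exact: level_energy_ge0.
  rewrite lee_wpmul2l ?lee_fin ?exprn_ge0 ?powR_ge0//.
  rewrite (bigD1 (Ordinal km))//= leeDl//.
  by apply: sume_ge0 => i _; rewrite lee_fin powR_ge0.
rewrite -EFinM lee_fin => h.
have e0 : (0 < (2 `^ (a * p)) ^+ m :> R)%R by rewrite exprn_gt0 ?powR_gt0.
have x0 : (0 <= x)%R by rewrite /x.
have : ((x `^ p) `^ p^-1 <= (g / (2 `^ (a * p)) ^+ m) `^ p^-1)%R.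
  apply: ge0_ler_powR; rewrite ?nnegrE ?invr_ge0 ?(ltW p0) ?powR_ge0//.
    by rewrite divr_ge0// ltW.
  by rewrite ler_pdivlMr// mulrC.
rewrite -powRrM divff ?gt_eqF// powRr1//.
rewrite powRM ?invr_ge0 ?(ltW e0)//.
suff -> : (((2 `^ (a * p)) ^+ m)^-1 `^ p^-1 = (2 `^ (- a)) ^+ m :> R)%R by [].
rewrite -!powR_mulrn ?powR_ge0// -powRN -!powRrM; congr (2 `^ _)%R.
rewrite !(mulrN, mulNr). congr (- _)%R.
by rewrite -mulrA (mulrCA p) divff ?mulr1 ?gt_eqF.
Qed.

End dyadic_energy.

Section holder_from_energy.
Context {R : realType} {E : normedModType R}.
Variables (T p a alpha : R).
Hypotheses (T_gt0 : 0 < T) (p_gt0 : 0 < p) (alpha_ge0 : 0 <= alpha).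
Hypothesis alpha_lt : alpha < a.

Definition chaining_cst : R :=
  (2 / (1 - 2 `^ (- a)) + 1) * 2 `^ a * (1 + T `^ (- alpha)).

Lemma chaining_cst_gt0 : 0 < chaining_cst.
Proof.
have a0 : 0 < a by apply: le_lt_trans alpha_lt.
rewrite !mulr_gt0 ?powR_gt0// ?addr_gt0 ?powR_gt0// divr_gt0// subr_gt0.
exact: powR2N_lt1.
Qed.

(** Since [|t - s| / T] is at most 1, the exponent [a] may be lowered to [alpha] in the seminorm, or
    the whole power dropped when [f t] is compared with [f 0]. *)
Lemma holder_norm_le (f : R -> E) (B : R) : 0 <= B ->
  (forall s t, 0 <= s <= T -> 0 <= t <= T ->
    `|f t - f s| <= B * (`|t - s| / T) `^ a) ->
  (holder_norm norme T alpha f <= (`|f 0%R| + B * (1 + T `^ (- alpha)))%:E)%E.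
Proof.
move=> B0 hf; have a0 : 0 < a by apply: le_lt_trans alpha_lt.
rewrite mulrDr mulr1 addrA EFinD; apply: leeD.
  apply: ge_ereal_sup => x [t]; rewrite /= in_itv /= => tT <-{x}.
  rewrite lee_fin -lerBlDl; apply: le_trans (lerB_dist _ _) _.
  apply: le_trans (hf 0 t _ tT) _; first by rewrite lexx ltW.
  rewrite ler_piMr// subr0; case/andP: tT => t0 tT.
  rewrite ger0_norm// [leRHS](_ : _ = 1 `^ a); last by rewrite powR1.
  apply: ge0_ler_powR; rewrite ?nnegrE ?(ltW a0) ?divr_ge0 ?(ltW T_gt0)//.
  by rewrite ler_pdivrMr ?mul1r.
apply: ge_ereal_sup => _ [[u v] /= [uT vT uv] <-].
rewrite in_itv /= in uT; rewrite in_itv /= in vT.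
have d0 : 0 < `|u - v| by rewrite normr_gt0 subr_eq0.
have dT : `|u - v| <= T.
  by move: uT vT; rewrite ler_norml => /andP[? ?] /andP[? ?]; apply/andP; split; lra.
rewrite inver gt_eqF ?powR_gt0// -EFinM lee_fin ler_pdivrMr ?powR_gt0//.
apply: le_trans (hf v u vT uT) _; rewrite -mulrA ler_wpM2l//.
apply: (@le_trans _ _ ((`|u - v| / T) `^ alpha)).
  by apply: ger_powR; rewrite ?divr_gt0 ?ler_pdivrMr ?mul1r//= ltW.
by rewrite powRM ?invr_ge0 ?(ltW T_gt0)// -powR_inv1 ?(ltW T_gt0)// -powRrM mulN1r mulrC.
Qed.

Lemma holder_norm_energy (f : R -> E) : {within `[0, T], continuous f} ->
  ((holder_norm norme T alpha f) `^ p <=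
   (2 `^ p)%:E * ((`|f 0%R| `^ p)%:E +
                  (chaining_cst `^ p)%:E * dyadic_energy T p a f))%E.
Proof.
move=> cf; have a0 : 0 < a by apply: le_lt_trans alpha_lt.
have p0 := ltW p_gt0; have c0 := chaining_cst_gt0.
have := dyadic_energy_ge0 T p a f.
(* For infinite energy the right-hand side is [+oo], because both constants in front of the energy
   are positive. *)
case EG : (dyadic_energy T p a f) => [g| |] // g0; last first.
  rewrite gt0_muley ?lte_fin ?powR_gt0// addey// gt0_muley ?lte_fin ?powR_gt0//.
  exact: leey.
have inc m k : (k < 2 ^ m)%N ->
    `|f (dyadic T m k.+1) - f (dyadic T m k)| <= g `^ p^-1 * (2 `^ (- a)) ^+ m.
  by move=> km; apply: dyadic_energy_inc km _ => //; rewrite EG.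
have hol := dyadic_holder T_gt0 a0 (powR_ge0 _ _) inc cf.
have K0 : 0 <= (2 / (1 - 2 `^ (- a)) + 1) * 2 `^ a :> R.
  move: (chaining_cst_gt0); rewrite /chaining_cst pmulr_lgt0; first exact: ltW.
  by rewrite addr_gt0 ?powR_gt0.
have := holder_norm_le (mulr_ge0 (powR_ge0 _ _) K0) hol.
rewrite -mulrA -/chaining_cst => le_h.
have n0 : (0 <= holder_norm norme T alpha f)%E.
  by apply: holder_norm_ge0 => // v; rewrite lee_fin.
apply: (@le_trans _ _ ((`|f 0| + g `^ p^-1 * chaining_cst)%:E `^ p)%E).
  by apply: gt0_ler_poweR; rewrite ?in_itv /= ?leey ?andbT// lee_fin addr_ge0// mulr_ge0 ?powR_ge0// ltW.
rewrite poweR_EFin -!EFinM lee_fin.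
apply: le_trans (powRD_le p_gt0 _ _) _ => //.
  by rewrite mulr_ge0 ?powR_ge0 ?(ltW c0).
rewrite ler_wpM2l ?powR_ge0// lerD2l powRM ?powR_ge0 ?(ltW c0)//.
by rewrite -powRrM mulVf ?gt_eqF// powRr1// mulrC.
Qed.

End holder_from_energy.

(** * The Kolmogorov-Chentsov moment bound *)

Lemma nneseries_geometric_le {R : realType} (c r : R) (u : nat -> \bar R) :
  0 <= c -> 0 <= r < 1 -> (forall m, 0 <= u m)%E ->
  (forall m, u m <= (c * r ^+ m)%:E)%E ->
  (\sum_(m <oo) u m <= (c / (1 - r))%:E)%E.
Proof.
move=> c0 /andP[r0 r1] u0 le_u.
apply: lime_le; first exact: is_cvg_nneseries.
apply: nearW => n; apply: (@le_trans _ _ (\sum_(0 <= m < n) (c * r ^+ m)%:E)%E).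
  by apply: lee_sum => m _; exact: le_u.
rewrite sumEFin lee_fin.
have r_neq1 : r != 1 by rewrite lt_eqF.
have := geometric_seriesE c r_neq1 => /(congr1 (fun h => h n)).
rewrite /series /geometric /= => ->.
rewrite ler_wpM2r ?invr_ge0 ?subr_ge0 ?(ltW r1)// ler_piMr// gerBl exprn_ge0//.
Qed.

Section kolmogorov_chentsov.
Context {R : realType} {E : normedModType R} {d : measure_display}
  {Omega : measurableType d} (P : probability Omega R).
Variables (T p alpha gamma : R).
Hypotheses (T_gt0 : 0 < T) (p_gt0 : 0 < p) (alpha_ge0 : 0 <= alpha).
Hypothesis alpha_lt : alpha + p^-1 < gamma.

Lemma dyadic_itv m k : (k <= 2 ^ m)%N -> dyadic T m k \in `[0, T].
Proof.
move=> km; rewrite in_itv /= mulr_ge0 ?divr_ge0 ?exprn_ge0 ?(ltW T_gt0)//=.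
by rewrite ler_piMr ?(ltW T_gt0)// ler_pdivrMr ?exprn_gt0// mul1r -natrX ler_nat.
Qed.

Lemma dyadic_inc m k : dyadic T m k.+1 - dyadic T m k = T / 2 ^+ m.
Proof.
by rewrite /dyadic -mulrBr -mulrBl -[k.+1%:R]natr1 addrAC subrr add0r mul1r.
Qed.

Section energy_integral.
Variables (a M : R) (X : R -> Omega -> E).
Hypothesis X_meas : forall t, t \in `[0, T] -> strongly_measurable (X t).
Hypothesis M_ge0 : 0 <= M.
Hypothesis X_inc : forall s t, s \in `[0, T] -> t \in `[0, T] ->
  (moment P p (X t - X s)%R <= (M * `|t - s| `^ (gamma * p))%:E)%E.

Let mterm m k : (k < 2 ^ m)%N -> measurable_fun setT (fun w =>
  (`|X (dyadic T m k.+1) w - X (dyadic T m k) w| `^ p)%:E).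
Proof.
move=> km; apply: (measurable_moment p (Z := X _ - X _)).
by apply: strongly_measurableB; apply: X_meas; apply: dyadic_itv => //; exact: ltnW.
Qed.

Let mlevel m : measurable_fun setT
  (fun w => \sum_(k < 2 ^ m)
    (`|X (dyadic T m k.+1) w - X (dyadic T m k) w| `^ p)%:E)%E.
Proof. by apply: emeasurable_sum => k; exact: mterm. Qed.

Let mlevel_energy m : measurable_fun setT
  (fun w => level_energy T p a (X ^~ w) m).
Proof. by apply: measurable_funeM; exact: mlevel. Qed.

Lemma measurable_dyadic_energy :
  measurable_fun setT (fun w => dyadic_energy T p a (X ^~ w)).
Proof.
by apply: ge0_emeasurable_sum => // m w _ _; exact: level_energy_ge0.
Qed.

(** Level [m] has $2^m$ increments of moment at most $M(T2^{-m})^{\gamma p}$ and weight $2^{apm}$;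
    hence the ratio $2^{ap+1-\gamma p}$. *)
Lemma integral_level_energy m :
  (\int[P]_w level_energy T p a (X ^~ w) m <=
  (M * T `^ (gamma * p) * (2 `^ (a * p + 1 - gamma * p)) ^+ m)%:E)%E.
Proof.
rewrite ge0_integralZl_EFin ?exprn_ge0 ?powR_ge0//; last first.
  by move=> w _; apply: sume_ge0 => k _; rewrite lee_fin powR_ge0.
rewrite ge0_integral_sum//; last by move=> k; exact: mterm.
apply: (@le_trans _ _ (((2 `^ (a * p)) ^+ m)%:E *
    \sum_(k < 2 ^ m) (M * (T / 2 ^+ m) `^ (gamma * p))%:E)%E).
  rewrite lee_wpmul2l ?lee_fin ?exprn_ge0 ?powR_ge0//.
  apply: lee_sum => k _.
  have := X_inc (dyadic_itv (ltnW (ltn_ord k))) (dyadic_itv (ltn_ord k)).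
  by rewrite dyadic_inc ger0_norm// divr_ge0 ?exprn_ge0 ?ltW.
rewrite sumEFin -EFinM lee_fin sumr_const card_ord.
rewrite powRM ?invr_ge0 ?exprn_ge0 ?(ltW T_gt0)//.
rewrite -[_ *+ (2 ^ m)]mulr_natr natrX.
set c := (_^-1 `^ _).
have -> : (2 `^ (a * p + 1 - gamma * p)) ^+ m =
    (2 `^ (a * p)) ^+ m * c * 2 ^+ m.
  rewrite /c -!powR_mulrn ?powR_ge0// -powRN -!powRrM -!powRD ?pnatr_eq0 ?implybT//.
  congr (_ `^ _); lra.
move: c => c; lra.
Qed.

Lemma integral_dyadic_energy : a * p + 1 < gamma * p ->
  (\int[P]_w dyadic_energy T p a (X ^~ w) <=
  (M * T `^ (gamma * p) / (1 - 2 `^ (a * p + 1 - gamma * p)))%:E)%E.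
Proof.
move=> ap; rewrite integral_nneseries//; last first.
  by move=> m w _; exact: level_energy_ge0.
apply: nneseries_geometric_le => [||m|m].
- by rewrite mulr_ge0 ?powR_ge0.
- by rewrite powR_ge0/= -(opprB (gamma * p)) powR2N_lt1// subr_gt0.
- by apply: integral_ge0 => w _; exact: level_energy_ge0.
- exact: integral_level_energy.
Qed.

End energy_integral.

(** [C] is chosen before the process, so it serves all [N] at once, and the bound is linear in [M0]
    and [M], so a power of the mesh contained in both passes to the conclusion. *)
Lemma kolmogorov_chentsov : exists2 C : R, 0 <= C & forall (M0 M : R) (X : R -> Omega -> E),
  0 <= M0 -> 0 <= M ->
  (forall t, t \in `[0, T] -> strongly_measurable (X t)) ->
  (forall w, {within `[0, T], continuous (X ^~ w)}) ->
  (moment P p (X 0%R) <= M0%:E)%E ->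
  (forall s t, s \in `[0, T] -> t \in `[0, T] ->
    (moment P p (X t - X s)%R <= (M * `|t - s| `^ (gamma * p))%:E)%E) ->
  (\int[P]_w (holder_norm norme T alpha (X ^~ w)) `^ p <= (C * (M0 + M))%:E)%E.
Proof.
(* The midpoint of [alpha] and [gamma - p^-1]: above [alpha], as chaining requires, and low enough
   for the energy series to converge. *)
pose a := (alpha + (gamma - p^-1)) / 2.
have alpha_a : alpha < a by rewrite /a; move: (p^-1) alpha_lt => u ?; lra.
have ap : a * p + 1 < gamma * p.
  have pV : p^-1 * p = 1 by rewrite mulVf ?gt_eqF.
  rewrite -[in ltLHS]pV -mulrDl ltr_pM2r// /a.
  by move: (p^-1) alpha_lt => u ?; lra.
have rho1 : 0 < 1 - 2 `^ (a * p + 1 - gamma * p) :> R.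
  by rewrite subr_gt0 -(opprB (gamma * p)) powR2N_lt1// subr_gt0.
pose K := T `^ (gamma * p) / (1 - 2 `^ (a * p + 1 - gamma * p)).
pose c := chaining_cst T a alpha `^ p.
have K0 : 0 <= K by rewrite divr_ge0 ?powR_ge0// ltW.
have c0 : 0 <= c by rewrite powR_ge0.
exists (2 `^ p * (1 + c * K)) => [|M0 M X M00 M_ge0 X_meas X_cont X0 X_inc].
  by rewrite mulr_ge0 ?powR_ge0// addr_ge0// mulr_ge0.
have mG := @measurable_dyadic_energy a X X_meas.
have G0 w : (0 <= c%:E * dyadic_energy T p a (X ^~ w))%E.
  by rewrite mule_ge0 ?dyadic_energy_ge0 ?lee_fin.
have T0 : (0 : R) \in `[0, T] by rewrite in_itv /= lexx ltW.
have mX0 := measurable_moment p (X_meas _ T0).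
apply: (@le_trans _ _ (\int[P]_w ((2 `^ p)%:E * ((`|X 0%R w| `^ p)%:E +
    c%:E * dyadic_energy T p a (X ^~ w))))%E).
  (* The Hölder norm is a supremum over uncountably many pairs; from here on only its measurable
     majorant is split and integrated. *)
  apply: le_integral_nonneg => w; first exact: poweR_ge0.
  exact: holder_norm_energy.
have mcG : measurable_fun setT (fun w => c%:E * dyadic_energy T p a (X ^~ w))%E.
  exact: measurable_funeM.
rewrite ge0_integralZl_EFin ?powR_ge0//; last first.
- exact: emeasurable_funD.
- by move=> w _; rewrite adde_ge0// lee_fin powR_ge0.
rewrite ge0_integralD//.
rewrite ge0_integralZl_EFin//; last by move=> w _; exact: dyadic_energy_ge0.
apply: (@le_trans _ _ ((2 `^ p)%:E * (M0%:E + c%:E * (M * K)%:E))%E).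
  rewrite lee_wpmul2l ?lee_fin ?powR_ge0// leeD// lee_wpmul2l ?lee_fin//.
  by rewrite /K mulrA; exact: integral_dyadic_energy.
rewrite -!EFinM lee_fin -mulrA ler_wpM2l ?powR_ge0//.
have : 0 <= c * K * M0 by rewrite mulr_ge0// mulr_ge0.
lra.
Qed.
End kolmogorov_chentsov.

(** * Time grids *)

Section grids.
Context {R : realType}.
Variables (T : R) (theta : {fset R}).
Hypotheses (T_gt0 : 0 < T) (gridT : time_grid T theta).

Lemma mem_knots t : (t \in knots theta) = (t \in theta).
Proof. by rewrite mem_sort. Qed.

Lemma knots_in j : (j < #|` theta|)%N -> (knots theta)`_j \in theta.
Proof. by move=> jn; rewrite -mem_knots mem_nth// size_knots. Qed.

Lemma grid_itv t : t \in theta -> t \in `[0, T].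
Proof. by case: gridT => sub _ _; exact: sub. Qed.

Lemma grid_size : (1 < #|` theta|)%N.
Proof.
case: gridT => _ h0 hT.
have /fsubset_leq_card : ([fset 0; T] `<=` theta)%fset.
  by apply/fsubsetP => x; rewrite !inE => /orP[] /eqP ->.
by rewrite cardfs2 (lt_eqF T_gt0).
Qed.

Lemma gapE j : (0 < j < #|` theta|)%N ->
  gap theta j = (knots theta)`_j - (knots theta)`_j.-1.
Proof.
case/andP => j0 jn; rewrite /gap gtr0_norm// subr_gt0 knots_lt//.
by rewrite prednK// leqnn.
Qed.

Lemma gap_gt0 j : (0 < j < #|` theta|)%N -> 0 < gap theta j.
Proof.
move=> jn; rewrite gapE// subr_gt0 knots_lt//.
by case/andP: jn => j0 jn; rewrite prednK// leqnn.
Qed.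

Lemma gap_dmax j : (0 < j < #|` theta|)%N -> gap theta j <= dmax theta.
Proof.
move=> jn; rewrite /dmax.
by apply: le_bigmax_seq; rewrite ?mem_index_iota.
Qed.

Lemma dmin_gap j : (0 < j < #|` theta|)%N -> dmin theta <= gap theta j.
Proof.
move=> jn; rewrite /dmin.
by apply: ge_bigmin_seq; rewrite ?mem_index_iota.
Qed.

Lemma dmax_gt0 : 0 < dmax theta.
Proof.
by apply: lt_le_trans (gap_dmax (j := 1) _); [apply: gap_gt0|];
  rewrite grid_size.
Qed.

Lemma dmin_gt0 : 0 < dmin theta.
Proof.
rewrite /dmin big_seq; apply: lt_bigmin; first by rewrite gap_gt0 ?grid_size.
by move=> j; rewrite mem_index_iota; exact: gap_gt0.
Qed.

Lemma dmax_le : dmax theta <= T.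
Proof.
rewrite /dmax big_seq; apply: bigmax_le; first exact: ltW.
move=> j; rewrite mem_index_iota => jn; rewrite gapE//.
case/andP: jn => j0 jn.
have := grid_itv (knots_in jn).
have := grid_itv (knots_in (leq_ltn_trans (leq_pred j) jn)).
rewrite !in_itv /= => /andP[? ?] /andP[? ?]; lra.
Qed.

(** The gap that ends at [j] already fits between the two knots. *)
Lemma knots_dmin i j : (i < j < #|` theta|)%N ->
  dmin theta <= (knots theta)`_j - (knots theta)`_i.
Proof.
move=> /andP[ij jn]; have j0 : (0 < j)%N by apply: leq_ltn_trans ij.
have jn' : (0 < j < #|` theta|)%N by rewrite j0.
apply: le_trans (dmin_gap jn') _; rewrite gapE// lerB//.
have : (i <= j.-1)%N by rewrite -ltnS prednK.
rewrite leq_eqVlt => /orP[/eqP ->//|ij1]; rewrite ltW// knots_lt// ij1.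
exact: leq_ltn_trans (leq_pred j) jn.
Qed.

Lemma grid_dmin s t : s \in theta -> t \in theta -> s != t ->
  dmin theta <= `|t - s|.
Proof.
rewrite -!mem_knots => /(nthP 0)[i + <-] /(nthP 0)[j + <-].
rewrite size_knots => i_lt j_lt st.
have [ij|ji|ij] := ltngtP i j.
- apply: le_trans (ler_norm _); apply: knots_dmin; by rewrite ij.
- rewrite distrC; apply: le_trans (ler_norm _); apply: knots_dmin; by rewrite ji.
- by rewrite ij eqxx in st.
Qed.

Lemma grid_bracket t : t \in `[0, T] -> exists2 j, (0 < j < #|` theta|)%N &
  (knots theta)`_j.-1 <= t <= (knots theta)`_j.
Proof.
rewrite in_itv /= => /andP[t0 tT]; have n1 := grid_size.
have [_ h0 hT] := gridT.
have has_t : has (fun x => t <= x) (knots theta).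
  by apply/hasP; exists T => //; rewrite mem_knots.
have := nth_find 0 has_t; have := before_find 0 (a := fun x => t <= x) (s := knots theta).
move: has_t; rewrite has_find size_knots.
case: (find _ _) => [_ _ t_le|j jn /(_ j (leqnn _)) t_gt t_le]; last first.
  by exists j.+1 => //=; rewrite t_le ltW// ltNge t_gt.
(* If the search stops at index 0, the first cell is taken: its left end is at most [0], which is
   itself a knot, hence at most [t]. *)
exists 1%N => //=; apply/andP; split.
  apply: le_trans t0; move: h0; rewrite -mem_knots => /(nthP 0)[[|i] + e].
    by rewrite e.
  by rewrite size_knots => i_lt; rewrite -[leRHS]e ltW// knots_lt.
by apply: le_trans t_le _; rewrite ltW// knots_lt.
Qed.

End grids.

(** * Moments of the approximations and of the error *)

Section moment_extra.
Context {d : measure_display} {Omega : measurableType d} {R : realType}.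
Context {E : normedModType R} (P : probability Omega R) (p : R).
Hypothesis p_gt0 : 0 < p.
Implicit Types Z : Omega -> E.

Lemma moment0 : moment P p (0 : Omega -> E) = 0%E.
Proof.
apply: integral0_eq => w _.
have -> : `|(0 : Omega -> E) w| = 0 by exact: normr0.
by rewrite powR0// gt_eqF.
Qed.

Lemma momentZ (c : R) Z : strongly_measurable Z ->
  moment P p (c *: Z) = ((`|c| `^ p)%:E * moment P p Z)%E.
Proof.
move=> mZ; rewrite -ge0_integralZl_EFin ?powR_ge0//; last first.
- exact: measurable_moment.
by apply: eq_integral => w _; rewrite -EFinM -powRM // -normrZ.
Qed.

(** The third term meets [momentD] only once; its factor [2]^ p[is raised to the common one since]2
    [^ p > 1] and [0 <= c]. *)
Lemma momentD3 Z1 Z2 Z3 (a b c : R) :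
  strongly_measurable Z1 -> strongly_measurable Z2 -> strongly_measurable Z3 ->
  0 <= c ->
  (moment P p Z1 <= a%:E)%E -> (moment P p Z2 <= b%:E)%E ->
  (moment P p Z3 <= c%:E)%E ->
  (moment P p (Z1 + Z2 + Z3)%R <= (2 `^ p * 2 `^ p * (a + b + c))%:E)%E.
Proof.
move=> m1 m2 m3 c0 h1 h2 h3.
apply: le_trans (momentD p_gt0 (strongly_measurableD m1 m2) m3
  (momentD p_gt0 m1 m2 h1 h2) h3) _.
rewrite lee_fin -mulrA ler_wpM2l ?powR_ge0// [leRHS]mulrDr lerD2l ler_peMl//.
exact/ltW/powR2_gt1.
Qed.

End moment_extra.

(** With [b = (b - g) + g], the smaller of [x] and [y] is replaced by the larger one in just one of
    the two partial powers. *)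
Lemma powR_interpolation {R : realType} (x y K m g b : R) :
  0 <= x -> 0 < y -> 0 <= K -> 0 < g <= b ->
  m <= K * x `^ b -> m <= K * y `^ b -> m <= K * (y `^ (b - g) * x `^ g).
Proof.
move=> x0 y0 K0 /andP[g0 gb] hx hy.
have b0 : 0 < b by apply: lt_le_trans gb.
have split_pow (z : R) : z `^ b = z `^ (b - g) * z `^ g.
  by rewrite -powRD ?subrK// gt_eqF.
have [xy|/ltW yx] := leP x y.
  apply: le_trans hx _; rewrite ler_wpM2l// split_pow ler_wpM2r ?powR_ge0//.
  by apply: ge0_ler_powR; rewrite ?nnegrE ?subr_ge0// ltW.
apply: le_trans hy _; rewrite ler_wpM2l// split_pow ler_wpM2l ?powR_ge0//.
by apply: ge0_ler_powR; rewrite ?nnegrE// ltW.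
Qed.

Section rate.
Context {R : realType} {E : normedModType R} {d : measure_display}
  {Omega : measurableType d} (P : probability Omega R).
Variables (T p beta : R) (theta : {fset R}) (U V : R -> Omega -> E) (A B : R).
Hypotheses (T_gt0 : 0 < T) (p_gt0 : 0 < p) (beta_itv : 0 < beta <= 1).
Hypothesis gridT : time_grid T theta.
Hypothesis U_meas : forall t, t \in `[0, T] -> strongly_measurable (U t).
Hypothesis V_meas : forall t, t \in `[0, T] -> strongly_measurable (V t).
Hypotheses (A_ge0 : 0 <= A) (B_ge0 : 0 <= B).
Hypothesis U_inc : forall s t, s \in `[0, T] -> t \in `[0, T] ->
  (moment P p (U t - U s)%R <= (A * `|t - s| `^ (beta * p))%:E)%E.
Hypothesis UV_grid : forall t, t \in theta ->
  (moment P p (U t - V t)%R <= (B * dmax theta `^ (beta * p))%:E)%E.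

Let bp_gt0 : 0 < beta * p.
Proof. by rewrite mulr_gt0//; case/andP: beta_itv. Qed.

Let mono (x y : R) : 0 <= x -> x <= y -> x `^ (beta * p) <= y `^ (beta * p).
Proof.
by move=> x0 xy; apply: ge0_ler_powR; rewrite ?nnegrE ?(ltW bp_gt0)// (le_trans x0).
Qed.

(** * Increments of affinely interpolated processes on quasi-uniform grids *)

Section interpolated.
Variable kappa : R.
Hypothesis dmax_dmin : dmax theta <= kappa * dmin theta.
Hypothesis V_interp : forall w t, t \in `[0, T] ->
  V t w = interp theta (V ^~ w) t.

(** The three summands belong to the error at [t], the increment of [U] and the error at [s]. *)
Definition grid_cst : R := 2 `^ p * 2 `^ p * (B * kappa `^ (beta * p) + A +
  B * kappa `^ (beta * p)).

Let kappa_ge0 : 0 <= kappa.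
Proof.
have := le_trans (ltW (dmax_gt0 T_gt0 gridT)) dmax_dmin.
by rewrite pmulr_lge0// (dmin_gt0 T_gt0 gridT).
Qed.

Lemma grid_cst_ge0 : 0 <= grid_cst.
Proof. by rewrite !mulr_ge0 ?powR_ge0// !addr_ge0// mulr_ge0 ?powR_ge0. Qed.

(** Distinct grid points are at least [dmin theta] apart, so [dmax theta] is at most
    [kappa * |t - s|] and the grid error is absorbed by the increment bound. *)
Lemma moment_inc_grid s t : s \in theta -> t \in theta ->
  (moment P p (V t - V s)%R <= (grid_cst * `|t - s| `^ (beta * p))%:E)%E.
Proof.
move=> sth tth; have [->|st] := eqVneq s t.
  by rewrite subrr moment0// lee_fin mulr_ge0 ?powR_ge0 ?grid_cst_ge0.
have sT := grid_itv gridT sth; have tT := grid_itv gridT tth.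
have dle : dmax theta `^ (beta * p) <= kappa `^ (beta * p) * `|t - s| `^ (beta * p).
  rewrite -powRM//; apply: mono; first exact/ltW/(dmax_gt0 T_gt0 gridT).
  apply: le_trans dmax_dmin _; rewrite ler_wpM2l//.
  exact: grid_dmin.
have hB r : r \in theta -> (moment P p (U r - V r)%R <=
    (B * kappa `^ (beta * p) * `|t - s| `^ (beta * p))%:E)%E.
  move=> rth; apply: le_trans (UV_grid rth) _.
  by rewrite lee_fin -mulrA ler_wpM2l.
have -> : V t - V s = (V t - U t) + (U t - U s) + (U s - V s).
  by rewrite !addrA !subrK.
have h1 := hB _ tth; rewrite momentBC in h1.
have := momentD3 p_gt0 (strongly_measurableB (V_meas tT) (U_meas tT))
  (strongly_measurableB (U_meas tT) (U_meas sT))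
  (strongly_measurableB (U_meas sT) (V_meas sT))
  _ h1 (U_inc sT tT) (hB _ sth).
by rewrite -!mulrDl mulrA; apply; rewrite !mulr_ge0 ?powR_ge0.
Qed.

Let k := knots theta.

(** Within a cell [V] is affine, so its increment is the fraction $(t-s)/h$ of the increment across
    the cell, to which the grid bound applies. *)
Lemma moment_inc_cell j s t : (0 < j < #|` theta|)%N ->
  k`_j.-1 <= s <= k`_j -> k`_j.-1 <= t <= k`_j ->
  (moment P p (V t - V s)%R <= (grid_cst * `|t - s| `^ (beta * p))%:E)%E.
Proof.
move=> jn sj tj; have [->|st] := eqVneq s t.
  by rewrite subrr moment0// lee_fin mulr_ge0 ?powR_ge0 ?grid_cst_ge0.
have h0 := gap_gt0 jn; have hE := gapE jn; set h := gap theta j in h0 hE.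
have jth : k`_j \in theta by apply: knots_in; case/andP: jn.
have j1th : k`_j.-1 \in theta.
  by apply: knots_in; case/andP: jn => _; exact: leq_ltn_trans (leq_pred j).
have jT := grid_itv gridT jth; have j1T := grid_itv gridT j1th.
have inT r : k`_j.-1 <= r <= k`_j -> r \in `[0, T].
  move: jT j1T; rewrite !in_itv /= => /andP[? ?] /andP[? ?] /andP[? ?].
  by apply/andP; split; lra.
have -> : V t - V s = ((t - s) / h) *: (V k`_j - V k`_j.-1).
  apply/funext => w.
  have VE r : k`_j.-1 <= r <= k`_j ->
      V r w = affine_between k`_j.-1 k`_j (V ^~ w) r.
    by move=> rj; rewrite V_interp ?inT// (interpE _ jn).
  suff : V t w - V s w = ((t - s) / h) *: (V k`_j w - V k`_j.-1 w) by [].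
  rewrite (VE _ tj) (VE _ sj) /affine_between -hE.
  rewrite opprD addrACA -!(scalerBl _ _ (V _ w)).
  have -> : (k`_j - t) / h - (k`_j - s) / h = - ((t - s) / h).
    by rewrite -mulrBl -mulNr; congr (_ / h); lra.
  have -> : (t - k`_j.-1) / h - (s - k`_j.-1) / h = (t - s) / h.
    by rewrite -mulrBl; congr (_ / h); lra.
  by rewrite scaleNr addrC -scalerBr.
rewrite momentZ; last by apply: strongly_measurableB; exact: V_meas.
have ts0 : 0 < `|t - s| by rewrite normr_gt0 subr_eq0 eq_sym.
have tsh : `|t - s| <= h.
  rewrite hE ler_norml; case/andP: sj => ? ?; case/andP: tj => ? ?.
  by apply/andP; split; lra.
apply: le_trans (lee_wpmul2l _ (moment_inc_grid j1th jth)) _.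
  by rewrite lee_fin powR_ge0.
rewrite -hE -EFinM lee_fin mulrCA ler_wpM2l ?grid_cst_ge0//.
rewrite normrM normfV !(gtr0_norm h0).
apply: (@le_trans _ _ ((`|t - s| / h) `^ (beta * p) * h `^ (beta * p))).
  (* The fraction is at most 1 and [beta <= 1], so its power [p] is at most its power [beta * p]. *)
  rewrite ler_wpM2r ?powR_ge0// ger_powR//.
    by rewrite divr_gt0//= ler_pdivrMr// mul1r.
  by rewrite ler_piMl ?(ltW p_gt0)//; case/andP: beta_itv.
by rewrite -powRM ?divr_ge0 ?(ltW h0)// divfK// gt_eqF.
Qed.

Lemma moment_inc_interp s t : s \in `[0, T] -> t \in `[0, T] ->
  (moment P p (V t - V s)%R <= (2 `^ p * 2 `^ p * (grid_cst + grid_cst + grid_cst) *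
    `|t - s| `^ (beta * p))%:E)%E.
Proof.
have C0 := grid_cst_ge0.
have C1 : grid_cst <= 2 `^ p * 2 `^ p * (grid_cst + grid_cst + grid_cst).
  have h2 : 1 <= 2 `^ p :> R by exact/ltW/powR2_gt1.
  apply: le_trans (_ : 1 * 1 * (grid_cst + grid_cst + grid_cst) <= _).
    by rewrite !mul1r; lra.
  by rewrite !ler_pM// ?mulr_ge0// !addr_ge0.
wlog st : s t / s <= t.
  move=> H sT tT; have [st|/ltW ts] := leP s t; first exact: H.
  by rewrite momentBC distrC; exact: H.
move=> sT tT.
have [i i_n si] := grid_bracket T_gt0 gridT sT.
have [j j_n tj] := grid_bracket T_gt0 gridT tT.
(* If [j <= i], then [s <= t] puts [t] in cell [i] too. Otherwise the path goes through the right
   end of the cell of [s] and the left end of the cell of [t]. *)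
have [ij|ji] := ltnP i j; last first.
  apply: le_trans (_ : (grid_cst * `|t - s| `^ (beta * p))%:E <= _)%E; last first.
    by rewrite lee_fin ler_wpM2r ?powR_ge0.
  apply: (moment_inc_cell (j := i)) => //.
  apply/andP; split; first by apply: le_trans st; case/andP: si.
  have [->|ij] := eqVneq i j; first by case/andP: tj.
  case/andP: tj => _ /le_trans; apply; rewrite ltW// knots_lt//.
  by rewrite ltn_neqAle eq_sym ij ji; case/andP: i_n.
have ith : k`_i \in theta by apply: knots_in; case/andP: i_n.
have j1th : k`_j.-1 \in theta.
  by apply: knots_in; case/andP: j_n => _; exact: leq_ltn_trans (leq_pred j).
have iT := grid_itv gridT ith; have j1T := grid_itv gridT j1th.
have kij : k`_i <= k`_j.-1.
  have : (i <= j.-1)%N by rewrite -ltnS prednK//; case/andP: j_n.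
  rewrite leq_eqVlt => /orP[/eqP ->//|ij1]; rewrite ltW// knots_lt// ij1.
  by case/andP: j_n => _; exact: leq_ltn_trans (leq_pred j).
have -> : V t - V s = (V t - V k`_j.-1) + (V k`_j.-1 - V k`_i) + (V k`_i - V s).
  by rewrite !addrA !subrK.
case/andP: (si) => si1 si2; case/andP: (tj) => tj1 tj2.
have kj_le : k`_j.-1 <= k`_j by apply: le_trans tj1 tj2.
have ki_le : k`_i.-1 <= k`_i by apply: le_trans si1 si2.
have weaken x y : s <= x -> x <= y -> y <= t ->
    (moment P p (V y - V x)%R <= (grid_cst * `|y - x| `^ (beta * p))%:E)%E ->
    (moment P p (V y - V x)%R <= (grid_cst * `|t - s| `^ (beta * p))%:E)%E.
  move=> sx xy yt /le_trans; apply; rewrite lee_fin ler_wpM2l// mono//.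
  by rewrite !ger0_norm ?subr_ge0//; lra.
have := momentD3 p_gt0 (strongly_measurableB (V_meas tT) (V_meas j1T))
  (strongly_measurableB (V_meas j1T) (V_meas iT))
  (strongly_measurableB (V_meas iT) (V_meas sT)) _
  (weaken _ _ _ _ _ (moment_inc_cell j_n _ _))
  (weaken _ _ _ _ _ (moment_inc_grid ith j1th))
  (weaken _ _ _ _ _ (moment_inc_cell i_n _ _)).
rewrite -!mulrDl mulrA; apply => //; rewrite ?lexx ?ki_le//.
- by rewrite mulr_ge0 ?powR_ge0.
- exact: le_trans si2 kij.
- exact: le_trans kij tj1.
Qed.

End interpolated.

(** * Size and increments of the error *)

Section error.
Variable C : R.
Hypothesis C_ge0 : 0 <= C.
Hypothesis V_inc : forall s t, s \in `[0, T] -> t \in `[0, T] ->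
  (moment P p (V t - V s)%R <= (C * `|t - s| `^ (beta * p))%:E)%E.

Let D t := U t - V t.

(** Moving from [t] to the left end of its cell costs one increment of [U] and one of [V], each over
    a distance at most [dmax theta]. *)
Lemma moment_error t : t \in `[0, T] -> (moment P p (D t) <=
  (2 `^ p * 2 `^ p * (A + B + C) * dmax theta `^ (beta * p))%:E)%E.
Proof.
move=> tT; have [j j_n /andP[tj1 tj2]] := grid_bracket T_gt0 gridT tT.
have j1th : (knots theta)`_j.-1 \in theta.
  by apply: knots_in; case/andP: j_n => _; exact: leq_ltn_trans (leq_pred j).
have j1T := grid_itv gridT j1th; set r := _`_j.-1 in tj1 j1th j1T.
have tr : `|t - r| `^ (beta * p) <= dmax theta `^ (beta * p).
  apply: mono => //; rewrite ger0_norm ?subr_ge0//.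
  apply: le_trans (gap_dmax j_n); rewrite gapE//.
  by rewrite lerD2r.
have -> : D t = (U t - U r) + (U r - V r) + (V r - V t).
  by rewrite !addrA !subrK.
have h1 : (moment P p (U t - U r)%R <= (A * dmax theta `^ (beta * p))%:E)%E.
  by apply: le_trans (U_inc j1T tT) _; rewrite lee_fin ler_wpM2l.
have h3 : (moment P p (V r - V t)%R <= (C * dmax theta `^ (beta * p))%:E)%E.
  by rewrite momentBC; apply: le_trans (V_inc j1T tT) _; rewrite lee_fin ler_wpM2l.
have := momentD3 p_gt0 (strongly_measurableB (U_meas tT) (U_meas j1T))
  (strongly_measurableB (U_meas j1T) (V_meas j1T))
  (strongly_measurableB (V_meas j1T) (V_meas tT)) _ h1 (UV_grid j1th) h3.
by rewrite -!mulrDl mulrA; apply; rewrite mulr_ge0 ?powR_ge0.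
Qed.

(** The sum of the constants of the two bounds that [powR_interpolation] combines, so that one
    constant dominates both. *)
Definition error_cst : R :=
  2 `^ p * (A + C) + 2 `^ p * (2 * (2 `^ p * 2 `^ p * (A + B + C))).

Lemma error_cst_ge0 : 0 <= error_cst.
Proof. by rewrite addr_ge0 ?mulr_ge0 ?powR_ge0// !addr_ge0. Qed.

(** The regularity of [U] and [V] bounds the increment by a power of [|t - s|], the smallness of [D]
    at both times by a power of the mesh; interpolation trades one for the other. *)
Lemma moment_error_inc gamma s t : 0 < gamma <= beta ->
  s \in `[0, T] -> t \in `[0, T] ->
  (moment P p (D t - D s)%R <=
   (error_cst * dmax theta `^ ((beta - gamma) * p) * `|t - s| `^ (gamma * p))%:E)%E.
Proof.
move=> /andP[g0 gb] sT tT; have d0 := dmax_gt0 T_gt0 gridT.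
have mU r := U_meas (t := r); have mV r := V_meas (t := r).
have mD r : r \in `[0, T] -> strongly_measurable (D r).
  by move=> rT; apply: strongly_measurableB; auto.
have K1 : 0 <= 2 `^ p * (A + C) by rewrite mulr_ge0 ?powR_ge0 ?addr_ge0.
have K2 : 0 <= 2 `^ p * (2 * (2 `^ p * 2 `^ p * (A + B + C))).
  by rewrite !mulr_ge0 ?powR_ge0// !addr_ge0.
have near_diag : (moment P p (D t - D s)%R <=
    (error_cst * `|t - s| `^ (beta * p))%:E)%E.
  have -> : D t - D s = (U t - U s) + (V s - V t).
    by rewrite /D opprB [V s - U s]addrC addrACA [- V t + V s]addrC.
  have h2 := V_inc sT tT; rewrite momentBC in h2.
  apply: le_trans (momentD p_gt0 (strongly_measurableB (mU _ tT) (mU _ sT))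
    (strongly_measurableB (mV _ sT) (mV _ tT)) (U_inc sT tT) h2) _.
  by rewrite lee_fin -mulrDl mulrA ler_wpM2r ?powR_ge0// lerDl.
have far_diag : (moment P p (D t - D s)%R <=
    (error_cst * dmax theta `^ (beta * p))%:E)%E.
  have h2 := moment_error sT; rewrite -momentN in h2.
  have mDs : strongly_measurable (- D s).
    by rewrite opprB; apply: strongly_measurableB; auto.
  apply: le_trans (momentD p_gt0 (mD _ tT) mDs (moment_error tT) h2) _.
  rewrite lee_fin -mulrDl mulrA ler_wpM2r ?powR_ge0//.
  by rewrite /error_cst; lra.
(* The interpolation inequality is between real numbers, so the moment must first be known to be
   finite. *)
have mfin : moment P p (D t - D s)%R \is a fin_num.
  by rewrite ge0_fin_numE ?moment_ge0// (le_lt_trans far_diag) ?ltey.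
rewrite -(fineK mfin) lee_fin -mulrA mulrBl.
apply: powR_interpolation => //; first exact: error_cst_ge0.
- by rewrite mulr_gt0//= ler_wpM2r// ltW.
- by rewrite -lee_fin fineK.
- by rewrite -lee_fin fineK.
Qed.

End error.
End rate.

(** * Real constants from the hypotheses, and the final estimate *)

Lemma ereal_sup_fin_bound {R : realType} {I : Type} (D : set I) (F : I -> \bar R) :
  (ereal_sup [set F i | i in D] < +oo)%E ->
  exists2 r : R, 0 <= r & forall i, D i -> (F i <= r%:E)%E.
Proof.
set s := ereal_sup _ => s_lt.
have Fs i : D i -> (F i <= s)%E by move=> Di; apply: ereal_sup_ubound; exists i.
case: s s_lt Fs => // [r _ Fr|_ FNy].
  exists (Num.max r 0) => [|i Di]; first by rewrite le_max lexx orbT.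
  by apply: le_trans (Fr i Di) _; rewrite lee_fin le_max lexx.
by exists 0 => // i Di; apply: le_trans (FNy i Di) _; rewrite leNye.
Qed.

Lemma holder_seminorm_moment {R : realType} {E : normedModType R}
    {d : measure_display} {Omega : measurableType d} (P : probability Omega R)
    (T p beta C : R) (X : R -> Omega -> E) : 0 < p -> 0 <= C ->
  (holder_seminorm (Lpnorm P p) T beta X <= C%:E)%E ->
  forall s t, s \in `[0, T] -> t \in `[0, T] ->
  (moment P p (X t - X s)%R <= (C `^ p * `|t - s| `^ (beta * p))%:E)%E.
Proof.
move=> p0 C0 hC s t sT tT; have [->|st] := eqVneq s t.
  by rewrite subrr moment0// lee_fin mulr_ge0 ?powR_ge0.
rewrite powRrM -powRM ?powR_ge0//; apply: moment_Lpnorm => //.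
  by rewrite mulr_ge0 ?powR_ge0.
have ts0 : 0 < `|t - s| `^ beta by rewrite powR_gt0 ?normr_gt0 ?subr_eq0 1?eq_sym.
rewrite EFinM -lee_pdivrMr//; apply: le_trans hC; apply: ereal_sup_ubound.
exists (t, s); first by split => //=; rewrite eq_sym.
by rewrite /= inver gt_eqF.
Qed.

Theorem corollary2p11 (R : realType) (T p beta : R)
    (hT : 0 < T) (hp : 1 < p) (hbeta : p^-1 < beta <= 1)
    (theta : nat -> {fset R})
    (htheta : forall N, (0 < N)%N -> time_grid T (theta N))
    (hmesh : limn_esup (fun N => (dmax (theta N))%:E) = 0%E)
    (d : measure_display) (Omega : measurableType d) (P : probability Omega R)
    (E : completeNormedModType R)
    (Y : nat -> R -> Omega -> E)
    (hmeas : forall N t, t \in `[0, T] -> strongly_measurable (Y N t))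
    (hcont : forall N w, {within `[0, T], continuous (fun t => Y N t w)})
    (hY00 : in_Lp P p (Y 0%N 0))
    (hrate : (holder_seminorm (Lpnorm P p) T beta (Y 0%N) +
       ereal_sup [set ((dmax (theta N)) `^ (- beta))%:E *
           ereal_sup [set Lpnorm P p (Y 0%N t - Y N t)%R | t in [set` theta N]]
         | N in [set N | (0 < N)%N]] < +oo)%E)
    (hab :
       (ereal_sup [set holder_seminorm (Lpnorm P p) T beta (Y N)
                  | N in [set N | (0 < N)%N]] < +oo)%E
       \/
       ((ereal_sup [set (dmax (theta N) / dmin (theta N))%:E
                   | N in [set N | (0 < N)%N]] < +oo)%E
        /\ forall N, (0 < N)%N -> forall w t, t \in `[0, T] ->
             Y N t w = interp (theta N) (fun s => Y N s w) t)) :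
  forall alpha eps : R, 0 <= alpha < beta - p^-1 -> 0 < eps ->
    (ereal_sup
      [set (\int[P]_w
              (holder_norm norme T alpha (fun t => Y N t w)) `^ p) +
           ((dmax (theta N)) `^ (- (beta - alpha - p^-1 - eps)))%:E *
           (\int[P]_w
              (holder_norm norme T alpha (fun t => Y 0%N t w - Y N t w)%R) `^ p)
             `^ p^-1
      | N in [set N | (0 < N)%N]] < +oo)%E.
Proof.
move=> alpha eps /andP[alpha0 alpha_lt] eps0.
have p0 : 0 < p by apply: lt_trans hp.
have pV0 : 0 < p^-1 by rewrite invr_gt0.
have beta_itv : 0 < beta <= 1.
  by case/andP: hbeta => /(lt_trans pV0) -> ->.
have T0 : (0 : R) \in `[0, T] by rewrite in_itv /= lexx ltW.
(* [gamma] exceeds [alpha + p^-1] by at most [eps], which keeps the rate, and by at most half of the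
   room left below [beta]. *)
have [gamma [alpha_gamma gamma_beta gamma_eps gamma0]] : exists g,
    [/\ alpha + p^-1 < g, g < beta, beta - alpha - p^-1 - eps <= beta - g & 0 < g].
  move: (p^-1) pV0 alpha_lt => u u0 alpha_u.
  exists (alpha + u + Num.min eps ((beta - u - alpha) / 2)).
  have e0 : 0 < Num.min eps ((beta - u - alpha) / 2).
    by rewrite lt_min eps0 divr_gt0// subr_gt0; lra.
  have e1 : Num.min eps ((beta - u - alpha) / 2) <= eps.
    by rewrite ge_min lexx.
  have e2 : Num.min eps ((beta - u - alpha) / 2) <= (beta - u - alpha) / 2.
    by rewrite ge_min lexx orbT.
  by move: (Num.min _ _) e0 e1 e2 => e *; split; lra.
have grid N (N0 : (0 < N)%N) := htheta N N0.
have d0 N (N0 : (0 < N)%N) := dmax_gt0 hT (grid N N0).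
have dT N (N0 : (0 < N)%N) := dmax_le hT (grid N N0).
have [A A0 U_holder] : exists2 A, 0 <= A &
    (holder_seminorm (Lpnorm P p) T beta (Y 0%N) <= A%:E)%E.
  move: hrate; set x := holder_seminorm _ _ _ _; set y := ereal_sup _ => xy.
  (* Finiteness of [x + y] bounds [x] once [y] is nonnegative; the index [N = 1] and the grid point
     [0] witness this. *)
  have y0 : (0 <= y)%E.
    apply: le_trans (ereal_sup_ubound _); last by exists 1%N.
    rewrite mule_ge0 ?lee_fin ?powR_ge0//.
    apply: le_trans (ereal_sup_ubound _); last first.
      by exists 0 => //; case: (grid 1%N isT).
    exact: Lnorm_ge0.
  have x0 : (0 <= x)%E by apply: holder_seminorm_ge0 => // Z; exact: Lnorm_ge0.
  have x_lt : (x < +oo)%E by apply: le_lt_trans xy; rewrite leeDl.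
  exists (fine x); first exact: fine_ge0.
  by rewrite fineK// ge0_fin_numE.
have [B B0 grid_rate] : exists2 B, 0 <= B & forall N, (0 < N)%N ->
    forall t, t \in theta N -> (moment P p (Y 0%N t - Y N t)%R <=
      (B * dmax (theta N) `^ (beta * p))%:E)%E.
  have /ereal_sup_fin_bound[B B0 hB] : (ereal_sup
      [set ((dmax (theta N)) `^ (- beta))%:E *
           ereal_sup [set Lpnorm P p (Y 0%N t - Y N t)%R | t in [set` theta N]]
         | N in [set N | (0 < N)%N]] < +oo)%E.
    apply: le_lt_trans hrate; rewrite leeDr//.
    by apply: holder_seminorm_ge0 => // Z; exact: Lnorm_ge0.
  exists (B `^ p) => [|N N0 t tN]; first exact: powR_ge0.
  rewrite powRrM -powRM ?powR_ge0//; apply: moment_Lpnorm => //.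
    by rewrite mulr_ge0 ?powR_ge0.
  rewrite mulrC EFinM -lee_pdivrMl ?powR_gt0 ?d0// -powRN.
  apply: le_trans (hB N N0); rewrite lee_wpmul2l ?lee_fin ?powR_ge0//.
  by apply: ereal_sup_ubound; exists t.
have U_inc := holder_seminorm_moment p0 A0 U_holder.
have Ap0 : 0 <= A `^ p by exact: powR_ge0.
(* Both alternatives are reduced to one increment bound, uniform in [N]; from here on the proof no
   longer distinguishes them. *)
have [C C0 V_inc] : exists2 C, 0 <= C & forall N, (0 < N)%N ->
    forall s t, s \in `[0, T] -> t \in `[0, T] ->
    (moment P p (Y N t - Y N s)%R <= (C * `|t - s| `^ (beta * p))%:E)%E.
  case: hab => [/ereal_sup_fin_bound[C C0 hC]|[/ereal_sup_fin_bound[k k0 hk] itp]].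
    exists (C `^ p) => [|N N0]; first exact: powR_ge0.
    by apply: holder_seminorm_moment => //; exact: hC.
  have dmax_dmin N : (0 < N)%N -> dmax (theta N) <= k * dmin (theta N).
    move=> N0; rewrite -ler_pdivrMr ?(dmin_gt0 hT (grid N N0))//.
    by have := hk N N0; rewrite lee_fin.
  eexists; last first.
    move=> N N0; apply: (moment_inc_interp hT p0 beta_itv (grid N N0)
      (hmeas 0%N) (hmeas N) Ap0 B0 U_inc (grid_rate N N0) (dmax_dmin N N0)).
    exact: itp.
  have gc0 := grid_cst_ge0 p beta Ap0 B0 k.
  by rewrite mulr_ge0 ?mulr_ge0 ?powR_ge0// !addr_ge0.
have [M0 M00 U0] : exists2 M0, 0 <= M0 & (moment P p (Y 0%N 0%R) <= M0%:E)%E.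
  case: hY00 => _ fin0; exists (fine (Lpnorm P p (Y 0%N 0)) `^ p).
    exact: powR_ge0.
  have L0 : (0 <= Lpnorm P p (Y 0%N 0%R))%E by exact: Lnorm_ge0.
  by apply: moment_Lpnorm => //; rewrite ?fine_ge0// fineK// ge0_fin_numE.
(* [C1], with exponent [beta], serves the processes themselves; [C2], with the smaller [gamma],
   serves the errors. *)
have [C1 C10 kol1] :=
  kolmogorov_chentsov (E := E) P hT p0 alpha0 (lt_trans alpha_gamma gamma_beta).
have [C2 C20 kol2] :=
  kolmogorov_chentsov (E := E) P hT p0 alpha0 alpha_gamma.
pose K := error_cst p (A `^ p) B C.
have K0 : 0 <= K by exact: error_cst_ge0.
(* In [S1] the moment of [Y N 0] is bounded through [Y 0 0] and the error at the grid point [0]. In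
   [S2] the surplus power of the mesh is replaced by a power of [T]. *)
pose S1 := C1 * (2 `^ p * (B * T `^ (beta * p) + M0) + C).
pose S2 := (C2 * (B * T `^ (gamma * p) + K)) `^ p^-1 *
  T `^ (beta - gamma - (beta - alpha - p^-1 - eps)).
apply: (@le_lt_trans _ _ (S1 + S2)%:E); last exact: ltey.
apply: ge_ereal_sup => x [N /= N0 <-]; rewrite EFinD.
have dN := d0 N N0; have dNT := dT N N0.
have bp0 : 0 <= beta * p by rewrite mulr_ge0 ?(ltW p0)//; case/andP: beta_itv => /ltW.
have gp0 : 0 <= gamma * p by rewrite mulr_ge0 ?ltW.
have zero_grid : (0 : R) \in theta N by case: (grid N N0).
have D0 := grid_rate N N0 _ zero_grid.
set dl := dmax (theta N) in dN dNT D0 *.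
have pow_le e : 0 <= e -> dl `^ e <= T `^ e.
  by move=> e0; apply: ge0_ler_powR; rewrite ?nnegrE// ltW.
apply: leeD.
  apply: (kol1 _ _ (Y N)) => //; last exact: V_inc.
  - by rewrite mulr_ge0 ?powR_ge0// addr_ge0// mulr_ge0 ?powR_ge0.
  - exact: hmeas.
  - have -> : Y N 0 = (Y N 0 - Y 0%N 0) + Y 0%N 0 by rewrite subrK.
    apply: momentD => //; [|exact: hmeas| ].
      by apply: strongly_measurableB; exact: hmeas.
    rewrite momentBC; apply: le_trans D0 _.
    by rewrite lee_fin ler_wpM2l// pow_le.
(* The initial error must carry the same mesh factor as the increments; the remaining power of [dl]
   is bounded by that of [T]. *)
have dE : dl `^ (beta * p) = dl `^ ((beta - gamma) * p) * dl `^ (gamma * p).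
  rewrite -powRD; first by rewrite -mulrDl subrK.
  by rewrite (gt_eqF dN) implybT.
have bg0 : 0 <= (beta - gamma) * p by rewrite mulr_ge0 ?subr_ge0 ?ltW.
have err : (\int[P]_w (holder_norm norme T alpha
    (fun t => Y 0%N t w - Y N t w)%R) `^ p <=
    (C2 * (B * T `^ (gamma * p) + K) * dl `^ ((beta - gamma) * p))%:E)%E.
  rewrite -mulrA mulrDl.
  apply: (kol2 _ _ (fun t => Y 0%N t - Y N t)).
  - by rewrite !mulr_ge0 ?powR_ge0.
  - by rewrite mulr_ge0 ?powR_ge0.
  - by move=> t tT; apply: strongly_measurableB; exact: hmeas.
  - move=> w t; apply: cvgB; exact: hcont.
  - apply: le_trans D0 _; rewrite lee_fin dE mulrA mulrAC.
    by rewrite ler_wpM2r ?powR_ge0// ler_wpM2l// pow_le.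
  - move=> s t sT tT; apply: (moment_error_inc hT p0 beta_itv (grid N N0)
      (hmeas 0%N) (hmeas N) Ap0 B0 U_inc (grid_rate N N0) C0 (V_inc N N0)) => //.
    by rewrite gamma0 ltW.
have S20 : 0 <= C2 * (B * T `^ (gamma * p) + K).
  by rewrite mulr_ge0// addr_ge0// mulr_ge0 ?powR_ge0.
apply: (@le_trans _ _ ((dl `^ (- (beta - alpha - p^-1 - eps)))%:E *
    (C2 * (B * T `^ (gamma * p) + K) * dl `^ ((beta - gamma) * p))%:E `^ p^-1)%E).
  rewrite lee_wpmul2l ?lee_fin ?powR_ge0//.
  apply: gt0_ler_poweR err; rewrite ?(ltW pV0)// in_itv /= leey andbT.
    by apply: integral_ge0 => w _; exact: poweR_ge0.
  by rewrite lee_fin mulr_ge0 ?powR_ge0.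
rewrite poweR_EFin -EFinM lee_fin powRM ?powR_ge0//.
rewrite -powRrM mulfK ?gt_eqF// mulrCA /S2 ler_wpM2l ?powR_ge0//.
(* By the choice of [gamma] the combined exponent is nonnegative, so [dl <= T] bounds the power
   uniformly in [N]. *)
rewrite mulrC -powRD ?(gt_eqF dN) ?implybT//; apply: pow_le.
by rewrite subr_ge0.
Qed.
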